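(* Let $\alpha>\frac12$. There exists a Sidon set $S_\alpha\subset\mathbb{N}^*$ such that $$\sum_{s\in S_\alpha}\frac{1}{s^\alpha}=\sup\Big\{\sum_{s\in S}s^{-\alpha} : S\subset\mathbb{N}^* \text{ is a Sidon set}\Big\}.$$
   Context: A Sidon set is a set $S$ of positive integers such that all the sums $s+s'$ with $s,s'\in S$, $s\le s'$, are distinct. $\mathbb{N}^*=\{1,2,3,\dots\}$. *)

(* Defs.v *)
From HB Require Import structures.
From mathcomp Require Import all_boot all_order all_algebra.
From mathcomp Require Import all_classical all_reals all_analysis.

Set Implicit Arguments.
Unset Strict Implicit.
Unset Printing Implicit Defensive.

Import Order.TTheory GRing.Theory Num.Theory.

Local Open Scope classical_set_scope.
Local Open Scope ring_scope.

Definition sidon (S : set nat) : Prop :=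
  (forall s, S s -> (0 < s)%N) /\
  (forall a b c d, S a -> S b -> S c -> S d ->
     (a <= b)%N -> (c <= d)%N -> (a + b = c + d)%N -> a = c /\ b = d).

(* The terms are nonnegative, so the sum always makes sense in [0, +oo]. *)
Definition inv_power_sum (R : realType) (alpha : R) (S : set nat) : \bar R :=
  \esum_(s in S) ((s%:R `^ (- alpha))%:E).

(* Main.v *)
Require Import Defs.
From HB Require Import structures.
From mathcomp Require Import all_boot all_order all_algebra.
From mathcomp Require Import all_classical all_reals all_analysis.
From mathcomp Require Import zify ring.

Set Implicit Arguments.
Unset Strict Implicit.
Unset Printing Implicit Defensive.

Import Order.TTheory GRing.Theory Num.Theory.

Local Open Scope classical_set_scope.
Local Open Scope ring_scope.

(* A Sidon set has at most sqrt 8 * 2^(k/2) elements in [2^k, 2^(k+1)), so for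
   alpha > 1/2 the tails of the sums are bounded by a convergent geometric
   series, uniformly over all Sidon sets.  An ultrafilter limit S of a
   maximizing sequence of Sidon sets is Sidon, and it agrees on every initial
   segment with members of the sequence whose sums are arbitrarily close to the
   supremum; by the uniform tail bound the sum over S attains the supremum. *)

Lemma sidon_block_count (T : set nat) (N : nat) : sidon T ->
  ((\sum_(N <= i < N.*2 | i \in T) 1) ^ 2 <= N * 8)%N.
Proof.
move=> [_ sT]; rewrite sum1_count -size_filter.
set s := [seq i <- _ | _].
have us : uniq s by rewrite filter_uniq// iota_uniq.
have memE x : x \in s -> T x /\ (x < N.*2)%N.
  by rewrite mem_filter mem_index_iota => /andP[/set_mem Tx /andP[]].
(* An ordered pair of elements is determined by its sum and by which of the
   two is the smaller. *)
pose f (x y : nat) := ((x + y)%N, (x <= y)%N).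
have uf : uniq [seq f x y | x <- s, y <- s].
  apply: allpairs_uniq => // -[a b] [c d].
  have memP x y : (x, y) \in [seq (u, v) | u <- s, v <- s] -> x \in s /\ y \in s.
    by move=> /allpairsP[[u v] /= [hu hv [-> ->]]].
  move=> /memP[ha hb] /memP[hc hd].
  have [Ta _] := memE _ ha; have [Tb _] := memE _ hb.
  have [Tc _] := memE _ hc; have [Td _] := memE _ hd.
  rewrite /f /= => -[e l].
  case: (leqP a b) l => lab /esym.
    by move=> lcd; have [-> ->] := sT _ _ _ _ Ta Tb Tc Td lab lcd e.
  move=> /negbT; rewrite -ltnNge => /ltnW ldc.
  by have [|-> ->] := sT _ _ _ _ Tb Ta Td Tc (ltnW lab) ldc; first lia.
(* Elements below [2N] have sums below [4N], so the codes take at most [8N] values. *)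
have sub : {subset [seq f x y | x <- s, y <- s] <=
    [seq (u, v) | u <- iota 0 (N * 4), v <- [:: true; false]]}.
  move=> _ /allpairsP[[x y] [/memE[_ xN] /memE[_ yN] ->]].
  apply: (allpairs_f pair); last by case: (_ <= _)%N.
  by rewrite mem_iota; move: xN yN => /=; lia.
have := uniq_leq_size uf sub; rewrite !size_allpairs size_iota/= -mulnn.
lia.
Qed.

Section PowerSums.
Variables (R : realType) (alpha : R).
Hypothesis halpha : 2^-1 < alpha.
Implicit Types T : set nat.

(** This is [2^(1/2 - alpha)]: passing to the next dyadic block doubles the count bound's square and
    scales the term bound by [2^(-alpha)]. *)
Let q : R := Num.sqrt 2 * 2 `^ (- alpha).

Let q_gt0 : 0 < q.
Proof. by rewrite mulr_gt0 ?sqrtr_gt0 ?powR_gt0. Qed.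

Let q_lt1 : q < 1.
Proof.
rewrite /q -powR12_sqrt// -powRD; last by rewrite pnatr_eq0 implybT.
have -> : (2 : R) `^ (2^-1 - alpha) = expR ((2^-1 - alpha) * ln 2).
  by rewrite /powR pnatr_eq0.
rewrite expR_lt1 nmulr_rlt0 ?ln_gt0 ?ltr1n//.
by rewrite subr_lt0.
Qed.

Let term (i : nat) : R := i%:R `^ (- alpha).

Definition partial_sum T (m n : nat) : R := \sum_(m <= i < n | i \in T) term i.

Lemma partial_sum_block T k : sidon T ->
  partial_sum T (2 ^ k) (2 ^ k.+1) <= Num.sqrt 8 * q ^+ k.
Proof.
move=> sT.
have a0 : 0 <= alpha by rewrite (le_trans _ (ltW halpha)) ?invr_ge0.
apply: (@le_trans _ _
    (\sum_(2 ^ k <= i < 2 ^ k.+1 | i \in T) (2 `^ (- alpha)) ^+ k)).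
  rewrite /partial_sum big_nat_cond [leRHS]big_nat_cond.
  apply: ler_sum => i /andP[/andP[ki _] _].
  rewrite -powR_mulrn ?powR_ge0// powRAC powR_mulrn// /term !powRN.
  rewrite lef_pV2 ?posrE ?powR_gt0 ?exprn_gt0// ?ltr0n; last first.
    by rewrite (leq_trans _ ki)// expn_gt0.
  by rewrite ge0_ler_powR ?nnegrE ?exprn_ge0// -natrX ler_nat.
set c := _ ^+ k.
under eq_bigr do rewrite -[c]mul1r.
rewrite -mulr_suml exprMn mulrA ler_wpM2r ?exprn_ge0 ?powR_ge0//.
rewrite -(natr_sum _ _ _ (fun=> 1%N)).
set m := (\sum_(_ <= _ < _ | _) _)%N.
have hm : (m ^ 2 <= 2 ^ k * 8)%N.
  by have := sidon_block_count (2 ^ k) sT; rewrite -muln2 -expnSr.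
(* Compare squares, since the count bound is on [m ^ 2]. *)
rewrite -(@ler_pXn2r _ 2) ?nnegrE ?mulr_ge0 ?exprn_ge0 ?sqrtr_ge0//.
rewrite exprMn -exprM mulnC exprM !sqr_sqrtr// mulrC.
by rewrite -!natrX -natrM ler_nat.
Qed.

(** The sum of the geometric series of block bounds [Num.sqrt 8 * q ^+ j]. *)
Let C : R := Num.sqrt 8 / (1 - q).

Lemma partial_sum_tail T k d : sidon T ->
  partial_sum T (2 ^ k) (2 ^ (k + d)) <= C * q ^+ k.
Proof.
move=> sT; have q1 : 0 < 1 - q by rewrite subr_gt0.
(* The exact finite geometric sum telescopes, so induction on [d] goes through:
   [C * (1 - q) = Num.sqrt 8]. *)
suff : partial_sum T (2 ^ k) (2 ^ (k + d)) <= C * (q ^+ k - q ^+ (k + d)).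
  move=> /le_trans; apply; rewrite ler_wpM2l//.
    by rewrite divr_ge0 ?sqrtr_ge0// ltW.
  by rewrite gerBl exprn_ge0// ltW.
elim: d => [|d IHd]; first by rewrite addn0 subrr mulr0 /partial_sum big_geq.
rewrite /partial_sum (@big_cat_nat _ _ _ (2 ^ (k + d)))/= ?leq_pexp2l//; try lia.
rewrite addnS; apply: le_trans (lerD IHd (partial_sum_block _ sT)) _.
rewrite le_eqVlt; apply/orP; left; apply/eqP.
by rewrite /C exprS; field; rewrite gt_eqF.
Qed.

Lemma partial_sum_le_inv_power_sum T n :
  ((partial_sum T 0 n)%:E <= inv_power_sum alpha T)%E.
Proof.
rewrite /inv_power_sum -[T in X in (_ <= X)%E]set_mem_set -nneseries_esum; last first.
  by move=> i _; rewrite lee_fin powR_ge0.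
rewrite /partial_sum -sumEFin; apply: nneseries_lim_ge => i _ _.
by rewrite lee_fin powR_ge0.
Qed.

Lemma inv_power_sum_le_partial_sum T k : sidon T ->
  (inv_power_sum alpha T <= (partial_sum T 0 (2 ^ k) + C * q ^+ k)%:E)%E.
Proof.
move=> sT.
have t0 i : (0 <= (term i)%:E)%E by rewrite lee_fin powR_ge0.
rewrite /inv_power_sum -[T in X in (X <= _)%E]set_mem_set -nneseries_esum//.
apply: lime_le; first exact: is_cvg_nneseries_cond.
apply: nearW => n; rewrite sumEFin lee_fin.
(* Extend the range to a power of 2, where the dyadic tail bound applies. *)
apply: (@le_trans _ _ (partial_sum T 0 (2 ^ (k + n)))).
  have nk : (n <= 2 ^ (k + n))%N.
    by rewrite (leq_trans (ltnW (ltn_expl n (isT : 1 < 2)%N)))// leq_pexp2l// leq_addl.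
  rewrite [leRHS](@big_cat_nat _ _ _ n)//= lerDl sumr_ge0// => i _.
  exact: powR_ge0.
rewrite /partial_sum (@big_cat_nat _ _ _ (2 ^ k))/= ?leq_pexp2l ?leq_addr//.
by rewrite lerD2l partial_sum_tail.
Qed.

Lemma geometric_tail_small (e : R) : 0 < e -> exists k, C * q ^+ k < e.
Proof.
move=> e0; have : geometric C q @ \oo --> 0.
  by apply: cvg_geometric; rewrite ger0_norm ?ltW.
move=> /cvgrPdist_lt/(_ _ e0)[k _ /(_ k (leqnn k))]; rewrite sub0r normrN.
by move=> /(le_lt_trans (ler_norm _)); exists k.
Qed.

Lemma inv_power_sum_sidon_bounded : exists M : R,
  forall T, sidon T -> (inv_power_sum alpha T <= M%:E)%E.
Proof.
(* Cut at [2 ^ 0]: the head then has only the index 0, which no Sidon set contains. *)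
exists C => T sT; apply: (le_trans (inv_power_sum_le_partial_sum 0 sT)).
rewrite lee_fin expr0 mulr1 gerDr /partial_sum big_mkcond/= big_nat1.
case: ifPn => // /set_mem T0.
by have := sT.1 _ T0.
Qed.

End PowerSums.

(** Finitely many memberships in the limit hold simultaneously in some [T n], which is Sidon. *)
Lemma ultra_sidon (F : set_system nat) (T : nat -> set nat) :
  UltraFilter F -> (forall n, sidon (T n)) -> sidon [set m | F [set n | T n m]].
Proof.
move=> UF sT; split => [s /filter_ex[n]|a b c d Fa Fb Fc Fd].
  exact: (sT n).1.
have [n [[Ta Tb] [Tc Td]]] := filter_ex (filterI (filterI Fa Fb) (filterI Fc Fd)).
exact: (sT n).2.
Qed.

(** For each [m], [F] contains the indices with [T n m] or their complement; either way [T n] agrees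
    with the limit at [m] on a set of [F]. Finitely many such sets are intersected. *)
Lemma ultra_initial_segment (F : set_system nat) (T : nat -> set nat) (N : nat) :
  UltraFilter F -> F [set n | forall m, (m < N)%N ->
    (T n m <-> F [set k | T k m])].
Proof.
move=> UF; elim: N => [|N IHN].
  by apply: filterS filterT => n _ m.
have agree : F [set n | T n N <-> F [set k | T k N]].
  have [FN|FnN] := in_ultra_setVsetC [set k | T k N] UF.
    by apply: filterS (FN) => n Tn; split.
  apply: filterS (FnN) => n nTn; split => // FN.
  by have [k []] := filter_ex (filterI FN FnN).
apply: filterS (filterI IHN agree) => n [Hlt HN] m.
by rewrite ltnS leq_eqVlt => /predU1P[->//|/Hlt].
Qed.

Theorem theorem1p2 (R : realType) (alpha : R) (halpha : 2^-1 < alpha) :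
  exists S : set nat,
    [/\ sidon S,
        (inv_power_sum alpha S < +oo)%E
      & inv_power_sum alpha S =
        ereal_sup [set inv_power_sum alpha T | T in [set T | sidon T]]].
Proof.
set E := [set inv_power_sum alpha T | T in _].
have [B HB] := inv_power_sum_sidon_bounded halpha.
have sid0 : sidon set0 by split.
have fE : ereal_sup E \is a fin_num.
  rewrite ge0_fin_numE.
    rewrite (@le_lt_trans _ _ B%:E) ?ltry//.
    by apply: ge_ereal_sup => _ [T sT <-]; exact: HB.
  apply: ereal_sup_ubound; exists set0 => //.
  by rewrite /inv_power_sum esum_set0.
have /choice[T HT] : forall n : nat, exists T, sidon T /\
    (ereal_sup E - (n.+1%:R^-1)%:E < inv_power_sum alpha T)%E.
  move=> n; have [|_ [T sT <-] lt] := @ub_ereal_sup_adherent R E n.+1%:R^-1 _ fE.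
    by rewrite invr_gt0.
  by exists T.
(* [F] refines the filter of cofinite sets, so it also sees the defect [1/(n+1)] become small. *)
have [F [UF ooF]] := ultraFilterLemma (@eventually_filter).
pose S := [set m | F [set n | T n m]].
have sS : sidon S by apply: ultra_sidon => n; have [] := HT n.
exists S; split => //; first by rewrite (le_lt_trans (HB _ sS)) ?ltry.
apply/eqP; rewrite eq_le; apply/andP; split.
  by apply: ereal_sup_ubound; exists S.
apply/lee_addgt0Pr => e e0.
(* Half of [e] pays for the tail beyond [2 ^ k], half for the defect of [T n] from the supremum. *)
have e20 : 0 < e / 2 by rewrite divr_gt0.
have [k Hk] := geometric_tail_small halpha e20.
have F_near : F [set n | n.+1%:R^-1 < e / 2].
  exact/ooF/(near_infty_natSinv_lt (PosNum e20)).
have [n [agree ne]] :=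
  filter_ex (filterI (ultra_initial_segment T (2 ^ k) UF) F_near).
have [sTn ltn] := HT n.
have eqp : partial_sum alpha (T n) 0 (2 ^ k) = partial_sum alpha S 0 (2 ^ k).
  rewrite /partial_sum big_nat_cond [RHS]big_nat_cond; apply: eq_bigl => i.
  case: (boolP (0 <= i < 2 ^ k)%N) => //= hi.
  by apply/idP/idP => /set_mem h; apply/mem_set/(agree i hi).
have := inv_power_sum_le_partial_sum halpha k sTn; rewrite eqp => le1.
have le2 := partial_sum_le_inv_power_sum alpha S (2 ^ k).
rewrite -(fineK fE) in ltn *.
have := lt_le_trans ltn le1; rewrite -EFinB lte_fin => lt1.
(* The head of [T n] is that of [S], so the supremum is below this head plus tail bound plus
   defect. *)
apply: (@le_trans _ _ ((partial_sum alpha S 0 (2 ^ k))%:E + e%:E)%E).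
  rewrite -EFinD lee_fin; apply: ltW; rewrite ltrBlDr in lt1.
  apply: (lt_le_trans lt1).
  by rewrite -addrA lerD2l [leRHS]splitr lerD// ltW.
exact: leeD2r.
Qed.
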